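(* Let $(W,S)$ be an arbitrary Coxeter system and let $\omega$ be a finite word in the generators $S$. There exists a reduced word $\omega'\subseteq\omega$ (a subword of $\omega$) for which $\omega'$-sorting is the same as $\omega$-sorting; that is, $W_{\omega'}=W_\omega$, and for every $u\in W_\omega$ the $\omega'$-sorted word of $u$, regarded as a subword of $\omega$ via $I(\omega')\subseteq I(\omega)$, equals the $\omega$-sorted word of $u$ (so the $\omega'$-sorting order and the $\omega$-sorting order coincide).
   Context: $\ell$ denotes the length function of $(W,S)$. Let $\omega=(\omega_1,\dots,\omega_m)$. A subword $\alpha\subseteq\omega$ is identified with its index set $I(\alpha)=\{i_1<\dots<i_k\}\subseteq I(\omega)=\{1,\dots,m\}$, with $\alpha=(\omega_{i_1},\dots,\omega_{i_k})$. For a word $\alpha=(\alpha_1,\dots,\alpha_k)$ write $\langle\alpha\rangle=\alpha_1\cdots\alpha_k\in W$; $\alpha$ is reduced if $k=\ell(\langle\alpha\rangle)$. $W_\omega\subseteq W$ is the set of elements $\langle\alpha\rangle$ for subwords $\alpha\subseteq\omega$. For finite sets of indices $A,B$, $A\leq_{\mathsf{lex}}B$ means $A=B$ or $\min((A\cup B)\setminus(A\cap B))\in A$. For $u\in W_\omega$, the $\omega$-sorted word $\mathsf{sort}_\omega(u)$ is the subword of $\omega$ whose index set is $\leq_{\mathsf{lex}}$-minimum among index sets of subwords of $\omega$ that are reduced words for $u$. The $\omega$-sorting order on $W_\omega$ is: $u\leq_\omega w$ iff $I(\mathsf{sort}_\omega(u))\subseteq I(\mathsf{sort}_\omega(w))$.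 A subword of $\omega'\subseteq\omega$ is regarded as a subword of $\omega$ by using the index positions inherited from $\omega$. The same definitions apply with $\omega'$ in place of $\omega$. *)

(* Defs.v *)
From mathcomp Require Import all_boot.
From mathcomp Require Import boolp classical_sets.

Set Implicit Arguments.
Unset Strict Implicit.
Unset Printing Implicit Defensive.

Definition is_word (W : groupType) (S : set W) (s : seq W) : Prop :=
  forall x, x \in s -> S x.

Definition word_prod (W : groupType) (s : seq W) : W :=
  \big[*%g/1%g]_(x <- s) x.

(* Only the values of [m] on [S] matter, and [m s t = 0] encodes the entry
   infinity; for distinct [s], [t] the last clause says that [m s t] is at
   least 2 or infinite. *)
Definition coxeter_matrix (W : groupType) (S : set W) (m : W -> W -> nat) :
    Prop :=
  forall s t, S s -> S t -> m s t = m t s /\ (m s t = 1 <-> s = t).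

(* The relation attached to an infinite entry is [(f s * f t) ^+ 0 = 1], which
   is no constraint. *)
Definition coxeter_relations (W G : groupType) (S : set W)
    (m : W -> W -> nat) (f : W -> G) : Prop :=
  forall s t, S s -> S t -> ((f s * f t) ^+ m s t = 1)%g.

(* [W] is presented by the generating set [S] and the relations
   [(s t)^(m s t) = 1]: these hold in [W], and any map from [S] to a group [G]
   that respects them extends to a homomorphism. By the relations
   [(s s)^1 = 1] no inverses are needed in the generation clause, and
   generation makes the extension unique. *)
Definition coxeter_presentation (W : groupType) (S : set W)
    (m : W -> W -> nat) : Prop :=
  [/\ forall u : W, exists2 s : seq W, is_word S s & word_prod s = u,
      coxeter_relations S m (fun x : W => x)
    & forall (G : groupType) (f : W -> G), coxeter_relations S m f ->
        exists phi : {multiplicative W -> G}, forall s, S s -> phi s = f s].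

Definition coxeter_system (W : groupType) (S : set W) : Prop :=
  exists2 m : W -> W -> nat, coxeter_matrix S m & coxeter_presentation S m.

(* [xget] picks the unique element of the given set; its first argument is a
   junk value for the case where the set is empty, which does not occur when
   [S] generates [W]. *)
Definition cox_length (W : groupType) (S : set W) (u : W) : nat :=
  xget 0 [set k | (exists s : seq W,
                      [/\ is_word S s, word_prod s = u & size s = k]) /\
                  (forall s : seq W,
                      is_word S s -> word_prod s = u -> k <= size s)]%classic.

Definition reduced (W : groupType) (S : set W) (s : seq W) : Prop :=
  size s = cox_length S (word_prod s).

(* The index set [I] determines the subword; [enum_val] lists [I] in increasing
   order. Positions start at 0. *)
Definition subword (W : groupType) (n : nat) (w : n.-tuple W) (I : {set 'I_n}) :
    #|I|.-tuple W :=
  [tuple tnth w (enum_val i) | i < #|I|].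

Definition subword_elts (W : groupType) (n : nat) (w : n.-tuple W) : set W :=
  [set u | exists I : {set 'I_n}, word_prod (subword w I) = u]%classic.

Definition lex_le (n : nat) (A B : {set 'I_n}) : Prop :=
  A = B \/
  exists i : 'I_n,
    [/\ i \in (A :|: B) :\: (A :&: B),
        forall j : 'I_n, j \in (A :|: B) :\: (A :&: B) -> i <= j
      & i \in A].

Definition reduced_subword_for (W : groupType) (S : set W) (n : nat)
    (w : n.-tuple W) (u : W) (I : {set 'I_n}) : Prop :=
  word_prod (subword w I) = u /\ reduced S (subword w I).

(* The index set of the sorted word of [u]. The minimum is unique as [lex_le]
   is antisymmetric, and it exists for [u] in [subword_elts w] in a Coxeter
   system, by the deletion property; [finset.set0] is a junk value for the
   other [u]. *)
Definition sort_idx (W : groupType) (S : set W) (n : nat) (w : n.-tuple W)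
    (u : W) : {set 'I_n} :=
  xget finset.set0
    [set I | reduced_subword_for S w u I /\
             forall J, reduced_subword_for S w u J -> lex_le I J]%classic.

Definition sorting_le (W : groupType) (S : set W) (n : nat) (w : n.-tuple W)
    (u v : W) : Prop :=
  sort_idx S w u \subset sort_idx S w v.

(* For [w' = subword w I]: the index set in [w] of the subword of [w'] with
   index set [J], under the inherited positions. *)
Definition inherited_idx (n : nat) (I : {set 'I_n}) (J : {set 'I_#|I|}) :
    {set 'I_n} :=
  [set enum_val i | i in J]%SET.

(* Main.v *)
(** Let s be a left descent of u when l(su) < l(u). Scanning [w] from the left
    and picking a letter whenever it is a left descent of what remains of [u]
    yields the sorted word of [u]. Hence a set of positions is sorted iff no
    letter of [w], picked or not, is a left descent of the product of the
    picked letters to its right; in particular sorted sets are reduced.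

    The union of all sorted sets is sorted, by induction on the prefixes of [w]:
    let [A] be the union for the current prefix, [t] the next letter and
    [B] (contained in [A]) such that [B t] is sorted. If [A t] is not, let [s]
    be the rightmost letter violating the condition, and let x and y be the
    products of the letters of [A] and [B] to its right. Then xt = sx by the
    exchange condition, so yt <= sx in the Bruhat order, and as [s] is not a
    descent of yt this gives yt <= x. So yt is a product of letters before [t],
    and its greedy sorted word does not use [t], contradicting the uniqueness of
    the sorted word of yt. The subword carried by this union is the required
    one. *)

From HB Require Import structures.
Require Import Defs.
From mathcomp Require Import all_boot.
From mathcomp Require Import boolp classical_sets.

Set Implicit Arguments.
Unset Strict Implicit.
Unset Printing Implicit Defensive.

Local Open Scope group_scope.

(** * The reflection cocycle of a Coxeter system *)

(* The semidirect product of [W] with the group of functions from [W] to Z/2. *)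
Definition parity_group (W : groupType) : Type := (W * (W -> bool))%type.

HB.instance Definition _ (W : groupType) :=
  Choice.copy (parity_group W) (W * (W -> bool))%type.

Section ParityGroup.
Variable W : groupType.
Implicit Types g h k : parity_group W.

Definition parity_mul g h : parity_group W :=
  (g.1 * h.1, fun x => g.2 x (+) h.2 (x ^ g.1)).
Definition parity_one : parity_group W := (1, fun=> false).
Definition parity_inv g : parity_group W :=
  (g.1^-1, fun x => g.2 (x ^ g.1^-1)).

Lemma parity_mulA : associative parity_mul.
Proof.
move=> g h k; congr pair; first exact: mulgA.
by apply/funext=> x /=; rewrite conjgM addbA.
Qed.

Lemma parity_mul1g : left_id parity_one parity_mul.
Proof.
by case=> a phi; congr pair; [exact: mul1g|apply/funext=> x /=; rewrite conjg1].
Qed.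

Lemma parity_mulg1 : right_id parity_one parity_mul.
Proof.
by case=> a phi; congr pair; [exact: mulg1|apply/funext=> x /=; rewrite addbF].
Qed.

Lemma parity_mulVg : left_inverse parity_one parity_inv parity_mul.
Proof.
by move=> g; congr pair; [exact: mulVg|apply/funext=> x /=; rewrite addbb].
Qed.

Lemma parity_mulgV : right_inverse parity_one parity_inv parity_mul.
Proof.
move=> g; congr pair; first exact: mulgV.
by apply/funext=> x /=; rewrite conjgK addbb.
Qed.

HB.instance Definition _ := isGroup.Build (parity_group W)
  parity_mulA parity_mul1g parity_mulg1 parity_mulVg parity_mulgV.

End ParityGroup.

Definition parity_gen (W : groupType) (s : W) : parity_group W :=
  (s, fun x => x == s).

(** The elements [(s t)^i s] with [i < 2k] are the reflections met along the word [(s t)^k]. *)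
Lemma parity_gen_pow (W : groupType) (s t : W) k :
  s * s = 1 -> t * t = 1 ->
  (parity_gen s * parity_gen t) ^+ k =
  ((s * t) ^+ k,
   fun x => \big[addb/false]_(0 <= i < k.*2) (x == (s * t) ^+ i * s))
    :> parity_group W.
Proof.
move=> ss tt.
have psp i : (s * t) ^+ i * s * (s * t) ^+ i = s.
  elim: i => [|i IH]; first by rewrite expg0 mulg1 mul1g.
  rewrite {1}expgSr expgS.
  rewrite -[RHS]IH -!mulgA; congr (_ * _); rewrite !mulgA; congr (_ * _).
  by rewrite -!mulgA (mulgA s s) ss mul1g tt mulg1.
have pP i : s * (s * t) ^- i = (s * t) ^+ i * s.
  by rewrite -{1}(psp i) mulgK.
elim: k => [|k IH].
  by rewrite !expg0; congr pair; apply/funext=> x /=; rewrite big_geq.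
rewrite expgSr IH; congr pair; first by rewrite expgSr.
apply/funext=> x /=; rewrite doubleS !big_nat_recr //= -addbA; congr (_ (+) _).
rewrite -conjgM; congr (_ (+) _).
  rewrite (can2_eq (conjgK _) (conjgKV _)) conjgE invgK pP.
  by rewrite mulgA -expgnDr addnn.
rewrite (can2_eq (conjgK _) (conjgKV _)) conjgE invgK.
have -> : ((s * t) ^+ k * s)^-1 = (s * t) ^+ k * s.
  by apply: mulg1_eq; rewrite mulgA psp.
by rewrite -addnn -addnS expgnDr expgS !mulgA.
Qed.

Lemma word_prod_cons (W : groupType) (s : W) l :
  word_prod (s :: l) = s * word_prod l.
Proof. by rewrite /word_prod big_cons. Qed.

Lemma word_prod_nil (W : groupType) : word_prod [::] = 1 :> W.
Proof. by rewrite /word_prod big_nil. Qed.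

Lemma word_prod_cat (W : groupType) (l1 l2 : seq W) :
  word_prod (l1 ++ l2) = word_prod l1 * word_prod l2.
Proof. by rewrite /word_prod big_cat. Qed.

Lemma word_prod_rcons (W : groupType) (l : seq W) t :
  word_prod (rcons l t) = word_prod l * t.
Proof. by rewrite -cats1 word_prod_cat word_prod_cons word_prod_nil mulg1. Qed.

Lemma is_word_cons (W : groupType) (S : set W) s l :
  is_word S (s :: l) -> S s /\ is_word S l.
Proof.
by move=> h; split=> [|x xl]; apply: h; rewrite inE ?eqxx ?xl ?orbT.
Qed.

Lemma is_word_subseq (W : groupType) (S : set W) (l l' : seq W) :
  subseq l' l -> is_word S l -> is_word S l'.
Proof. by move=> /mem_subseq sub h x /sub /h. Qed.

Lemma coxeter_gen_involutive (W : groupType) (S : set W) s :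
  coxeter_system S -> S s -> s * s = 1.
Proof.
move=> [m mat [_ rel _]] Ss.
by have := rel s s Ss Ss; rewrite (proj2 (mat s s Ss Ss)).2 // expg1.
Qed.

(* [N u x] is the parity of the number of times the reflection [x] occurs in
   the sequence [s_1 ... s_i ... s_1], for any word [s_1 ... s_k] for [u]. *)
Lemma reflection_cocycle (W : groupType) (S : set W) : coxeter_system S ->
  exists N : W -> W -> bool,
    (forall u v x, N (u * v) x = N u x (+) N v (x ^ u)) /\
    (forall s x, S s -> N s x = (x == s)).
Proof.
move=> cS; case: (cS) => m _ [gen rel univ].
have [|phi phiE] := univ _ (@parity_gen W).
  move=> s t Ss St; rewrite parity_gen_pow;
    try exact: coxeter_gen_involutive cS _.
  have pm := rel s t Ss St; rewrite pm; congr pair; apply/funext=> x.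
  (* With [k = m s t], the relation makes the reflections of indices [i] and [k + i] equal, so the
     two halves of the sum cancel. *)
  rewrite -addnn (@big_cat_nat _ _ _ (m s t)) ?leq_addr //=.
  rewrite -{1}[X in _ (+) \big[_/_]_(X <= _ < _) _]add0n big_addn addnK.
  rewrite [X in _ (+) X](eq_bigr (fun i => x == (s * t) ^+ i * s)) ?addbb //.
  by move=> i _; rewrite expgnDr pm mulg1.
have phi1 u : (phi u).1 = u.
  have [l + <-] := gen u; elim: l => [_|s l IH /is_word_cons[Ss /IH {}IH]].
    by rewrite word_prod_nil (@mulgI _ (phi 1) (phi 1) 1) // -gmulfM !mulg1.
  by rewrite word_prod_cons gmulfM /= IH phiE.
exists (fun u x => (phi u).2 x); split=> [u v x|s x Ss].
  by rewrite gmulfM /= phi1.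
by rewrite phiE.
Qed.

Lemma word_of (W : groupType) (S : set W) (u : W) :
  coxeter_system S -> exists2 l, is_word S l & word_prod l = u.
Proof. by move=> [m _ [gen _ _]]. Qed.

(** * Descents, deletion and the greedy scan *)

Section Cocycle.
Variables (W : groupType) (S : set W) (N : W -> W -> bool).
Hypothesis S_inv : forall s, S s -> s * s = 1.
Hypothesis NM : forall u v x, N (u * v) x = N u x (+) N v (x ^ u).
Hypothesis NS : forall s x, S s -> N s x = (x == s).
Implicit Types (s t u v x y : W) (l w : seq W) (m b g : bitseq).

Lemma cocycle1 x : N 1 x = false.
Proof. by have := NM 1 1 x; rewrite mulg1 conjg1 addbb. Qed.

Lemma gen_inv s : S s -> s^-1 = s.
Proof. by move=> /S_inv; apply: mulg1_eq. Qed.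

Lemma gen_mulK s x : S s -> s * (s * x) = x.
Proof. by move=> Ss; rewrite mulgA S_inv // mul1g. Qed.

(* So, for [s] in [S], [N u s] says that [s] is a left descent of [u]. *)
Lemma descent_mull s x : S s -> N (s * x) s = ~~ N x s.
Proof. by move=> Ss; rewrite NM NS // eqxx conjgE mulKg addTb. Qed.

Lemma cocycle_mulr x t r : S t -> N (x * t) r = N x r (+) (r ^ x == t).
Proof. by move=> St; rewrite NM (NS _ St). Qed.

(** Odd parity forces [r] to be one of the reflections [s_1 ... s_i ... s_1] of [l]; multiplying by
    it strikes out the letter [s_i]. *)
Lemma deletion l r : is_word S l -> N (word_prod l) r ->
  exists l', [/\ subseq l' l, (size l').+1 = size l
                & word_prod l' = r * word_prod l].
Proof.
elim: l r => [|s l IH] r; first by rewrite word_prod_nil cocycle1.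
move=> /is_word_cons[Ss wl]; rewrite word_prod_cons NM NS //.
have [-> _|_ /= /(IH _ wl) [l' [sub sz pl']]] := eqVneq r s.
  by exists l; rewrite subseq_cons gen_mulK.
exists (s :: l'); split; rewrite /= ?eqxx ?sz //.
by rewrite word_prod_cons pl' conjgE -!mulgA mulVKg.
Qed.

(* A form of being reduced that involves no length; see [reducedP]. *)
Fixpoint descent_free l :=
  if l is s :: l' then ~~ N (word_prod l') s && descent_free l' else true.

(* The condition on [s] does not depend on whether [m] selects [s]. *)
Fixpoint sorted_mask w m :=
  if w is s :: w' then
    if m is b :: m' then ~~ N (word_prod (mask m' w')) s && sorted_mask w' m'
    else true
  else true.

Fixpoint greedy w u : bitseq :=
  if w is s :: w' then
    N u s :: greedy w' (if N u s then s * u else u)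
  else [::].

Definition elts w u := exists2 c, subseq c w & word_prod c = u.

Lemma size_greedy w u : size (greedy w u) = size w.
Proof. by elim: w u => //= s w IH u; rewrite IH. Qed.

Lemma sorted_mask_descent_free w m : sorted_mask w m -> descent_free (mask m w).
Proof.
by elim: w m => [|s w IH] [|[] m] //= /andP[ns /IH]; rewrite // ns.
Qed.

(** Sortedness makes a picked letter a descent of what remains and an unpicked one a non-descent, so
    the scan repeats the choices of [m]. *)
Lemma greedy_unique w m : is_word S w -> size m = size w -> sorted_mask w m ->
  greedy w (word_prod (mask m w)) = m.
Proof.
elim: w m => [|s w IH] [|b m] //= /is_word_cons[Ss ww] [sz] /andP[ns sm].
have {}IH := IH m ww sz sm; case: b => /=; last by rewrite (negPf ns) IH.
by rewrite word_prod_cons descent_mull // ns gen_mulK // IH.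
Qed.

(** The invariant of the greedy scan: where a given subword disagrees with the greedy choice at [s],
    deletion supplies another subword of [w]. *)
Lemma elts_cons s w u : is_word S (s :: w) -> elts (s :: w) u ->
  elts w (if N u s then s * u else u).
Proof.
move=> /is_word_cons[Ss ww] [c sub <-].
have del c' r : subseq c' w -> N (word_prod c') r -> elts w (r * word_prod c').
  move=> sub' /(deletion (is_word_subseq sub' ww)) [d [dc' _ <-]].
  by exists d => //; apply: subseq_trans sub'.
have {sub} [sub|[c' -> sub]] :
    subseq c w \/ exists2 c', c = s :: c' & subseq c' w.
  case: c sub => [|x c] /=; first by left; rewrite sub0seq.
  by case: eqP => [->|_]; [right; exists c|left].
  by case: ifP => [/del|_]; [apply|exists c].
rewrite word_prod_cons descent_mull //.
case: ifPn => [_|/negbNE /del]; last exact.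
by exists c'; rewrite // gen_mulK.
Qed.

Lemma greedyP w u : is_word S w -> elts w u ->
  sorted_mask w (greedy w u) /\ word_prod (mask (greedy w u) w) = u.
Proof.
elim: w u => [|s w IH] u ww eu /=.
  by case: eu => c; rewrite subseq0 => /eqP-> <-.
have [Ss wwt] := is_word_cons ww; move: (elts_cons ww eu).
case us: (N u s) => /(IH _ wwt) /= [sm pm]; rewrite sm pm ?us //.
by rewrite word_prod_cons pm descent_mull ?us ?gen_mulK.
Qed.

(** * The Bruhat order and its subword property *)

(* [N w r] holds only for reflections [r], and says that [r * w] is shorter than
   [w]. *)
Inductive bruhat v : W -> Prop :=
| bruhat_refl : bruhat v v
| bruhat_step (w r : W) : N w r -> bruhat v (r * w) -> bruhat v w.

(** Conjugation by [s] turns a step down from [w] along [r] into one from [s * w], except for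
    [r = s], which yields the first alternative. *)
Lemma bruhat_mull s v (w : W) : S s -> bruhat v w ->
  bruhat (s * v) w \/ bruhat (s * v) (s * w).
Proof.
move=> Ss; elim=> [|{}w r Nwr _ [IH|IH]]; first by right; apply: bruhat_refl.
  by left; apply: bruhat_step Nwr IH.
have [rs|rs] := eqVneq r s; first by left; rewrite rs gen_mulK in IH.
right; apply: (@bruhat_step _ _ (r ^ s)).
  by rewrite NM NS // (can2_eq (conjgK _) (conjgKV _)) gen_inv // conjgE mulKg
     (negPf rs) -conjgM S_inv // conjg1.
by rewrite conjgE gen_inv // -!mulgA gen_mulK.
Qed.

(** Prefixing a letter to a reduced word goes up in the order; if the letter is a descent of [v], it
    is stripped and then restored by [bruhat_mull]. *)
Lemma bruhat_subword l v : is_word S l -> descent_free l -> elts l v ->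
  bruhat v (word_prod l).
Proof.
elim: l v => [|s l IH] v.
  by move=> _ _ [c]; rewrite subseq0 => /eqP-> <-; apply: bruhat_refl.
move=> wl /= /andP[ns fl] ev; have [Ss ww] := is_word_cons wl.
rewrite word_prod_cons.
have up x : bruhat x (word_prod l) -> bruhat x (s * word_prod l).
  move=> le; apply: (@bruhat_step _ _ s); first by rewrite descent_mull.
  by rewrite gen_mulK.
have := IH _ ww fl (elts_cons wl ev); case: ifP => _; last exact: up.
by move=> /(bruhat_mull Ss); rewrite gen_mulK // => -[/up|].
Qed.

(** Each step down is a deletion. *)
Lemma elts_bruhat w u v : is_word S w -> bruhat v u -> elts w u -> elts w v.
Proof.
move=> ww; elim=> // {}u r Nur _ IH [c cw uE]; apply: IH.
have [||c' [sub _ pc']] := @deletion c r; first exact: is_word_subseq ww.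
  by rewrite uE.
by exists c'; [apply: subseq_trans cw|rewrite pc' uE].
Qed.

(** Appending [t] changes the parity only at the reflection [x t x^-1], which must therefore be
    [s]. *)
Lemma exchange x t s : S t -> ~~ N x s -> N (x * t) s -> x * t = s * x.
Proof.
move=> St /negPf ns; rewrite cocycle_mulr // ns => /eqP <-.
by rewrite -conjgC.
Qed.

(* The lifting property of the Bruhat order for [y * t] and [x * t = s * x],
   where [x] is the product of [a]. *)
Lemma elts_exchange a s t y : S s -> is_word S (rcons a t) ->
    descent_free (rcons a t) ->
    ~~ N (word_prod a) s -> N (word_prod a * t) s ->
    elts a y -> ~~ N (y * t) s ->
  elts a (y * t).
Proof.
move=> Ss wat fat nx nxt [c sub <-] /negPf nyt.
have St : S t by apply: wat; rewrite mem_rcons mem_head.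
have wa : is_word S a by apply: is_word_subseq wat; apply: subseq_rcons.
have wsa : is_word S (s :: a) by move=> z; rewrite inE => /orP[/eqP->|/wa].
have := @bruhat_subword _ (word_prod c * t) wat fat.
rewrite word_prod_rcons (exchange St nx nxt) => le.
(* Being below [s * x], the element is carried by a subword of [s :: a]; as [s] is not a descent of
   it, the greedy step skips [s]. *)
have /(elts_cons wsa) : elts (s :: a) (word_prod c * t).
  apply: elts_bruhat wsa (le _) _.
    by exists (rcons c t); [rewrite -!cats1 cat_subseq|rewrite word_prod_rcons].
  by exists (s :: a); rewrite // word_prod_cons.
by rewrite nyt.
Qed.

(** * The union of all sorted sets *)

(** In a reduced word the reflection contributed by the last letter is none of the earlier ones;
    hence appending [t] keeps every descent. *)
Lemma descent_free_rcons l t r : is_word S (rcons l t) ->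
  descent_free (rcons l t) -> N (word_prod l) r -> r ^ word_prod l != t.
Proof.
elim: l r => [|s l IH] r /=; first by rewrite word_prod_nil !cocycle1.
move=> /is_word_cons[Ss wlt].
have St : S t by apply: wlt; rewrite mem_rcons mem_head.
rewrite word_prod_rcons cocycle_mulr // word_prod_cons NM => /andP[ns fl].
have sN : s ^ word_prod l != t.
  apply/negP=> st; move: ns; rewrite st addbT negbK => /(IH _ wlt fl).
  by rewrite st.
rewrite conjgM; have [->|rs] := eqVneq r s; first by rewrite conjgE mulKg.
by rewrite NS // (negPf rs) => /(IH _ wlt fl).
Qed.

Lemma submask_subseq w b m : size b = size w -> size m = size w ->
  (forall i, nth false b i -> nth false m i) -> subseq (mask b w) (mask m w).
Proof.
elim: w b m => [|s w IH] [|x b] [|y m] //= [szb] [szm] sub.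
have {}IH := IH b m szb szm (fun i => sub i.+1); have := sub 0.
case: x y {sub} => [] [] //= sub0; first by rewrite eqxx.
- by have := sub0 isT.
- exact: subseq_trans (subseq_cons _ _).
Qed.

Lemma sorted_mask_rcons_false w m t : size m = size w ->
  sorted_mask (rcons w t) (rcons m false) = sorted_mask w m.
Proof.
elim: w m => [|s w IH] [|b m] //=; first by rewrite word_prod_nil cocycle1.
move=> [sz].
by rewrite IH // mask_rcons // cats0.
Qed.

(** By [descent_free_rcons], a violation in the prefix would survive appending [t]. *)
Lemma sorted_mask_rcons_true w m t : is_word S (rcons w t) -> size m = size w ->
  sorted_mask (rcons w t) (rcons m true) -> sorted_mask w m.
Proof.
elim: w m => [|s w IH] [|b m] //= /is_word_cons[_ wwt] [sz] /andP[ns sm].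
rewrite IH // andbT; apply: contra ns => ns.
have St : S t by apply: wwt; rewrite mem_rcons mem_head.
have sub : subseq (rcons (mask m w) t) (rcons w t).
  by rewrite -!cats1 cat_subseq ?mask_subseq.
rewrite mask_rcons // cats1 word_prod_rcons cocycle_mulr // ns addTb.
apply: descent_free_rcons ns; first exact: is_word_subseq wwt.
by have := sorted_mask_descent_free sm; rewrite mask_rcons // cats1.
Qed.

Lemma sorted_mask_add w t m b : is_word S (rcons w t) ->
    size m = size w -> size b = size w -> sorted_mask w m ->
    sorted_mask (rcons w t) (rcons b true) ->
    (forall i, nth false b i -> nth false m i) ->
  sorted_mask (rcons w t) (rcons m true).
Proof.
elim: w m b => [|s w IH] [|x m] [|y b] //= ww [szm] [szb] /andP[nm sm].
move=> /andP[nb sb] sub; have {}sub i := sub i.+1.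
have [Ss wwt] := is_word_cons ww.
have St : S t by apply: wwt; rewrite mem_rcons mem_head.
(* The tail satisfies the condition by induction, so a violation at [s] is the rightmost one. *)
have {IH} sm' := IH m b wwt szm szb sm sb sub; rewrite sm' andbT.
move: (nb); rewrite !mask_rcons // !cats1 !word_prod_rcons => nb'.
apply/negP => nmt.
have wm : is_word S (rcons (mask m w) t).
  apply: is_word_subseq wwt; rewrite -!cats1 cat_subseq ?mask_subseq //.
have fm : descent_free (rcons (mask m w) t).
  by have := sorted_mask_descent_free sm'; rewrite mask_rcons // cats1.
have [|c cm pc] := elts_exchange Ss wm fm nm nmt _ nb'.
  by exists (mask b w) => //; apply: submask_subseq.
have ew : elts w (word_prod (mask b w) * t).
  by exists c => //; apply: subseq_trans cm (mask_subseq _ _).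
have ww' : is_word S w by apply: is_word_subseq wwt; apply: subseq_rcons.
have [sg pg] := greedyP ww' ew.
set g := greedy w _ in sg pg; have szg : size g = size w by apply: size_greedy.
(* Both [rcons g false] and [rcons b true] are sorted masks for the same element, yet their last
   bits differ. *)
have := @greedy_unique (rcons w t) (rcons g false) wwt.
have := @greedy_unique (rcons w t) (rcons b true) wwt.
rewrite !size_rcons szb szg sorted_mask_rcons_false //.
rewrite !mask_rcons // cats0 cats1.
rewrite word_prod_rcons pg => -> // /(_ erefl sg) /(congr1 (last true)).
by rewrite !last_rcons.
Qed.

Lemma max_sorted_mask w : is_word S w -> exists m,
  [/\ size m = size w, sorted_mask w m &
    forall b, size b = size w -> sorted_mask w b ->
      forall i, nth false b i -> nth false m i].
Proof.
elim/last_ind: w => [|w t IH] wwt.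
  by exists [::]; split=> // b /size0nil -> _ i; rewrite nth_nil.
have ww : is_word S w by apply: is_word_subseq wwt; apply: subseq_rcons.
have [m [szm sm maxm]] := IH ww.
have [[b [szb sb]]|no] := pselect (exists b, size b = size w /\
                              sorted_mask (rcons w t) (rcons b true)).
  exists (rcons m true); split; first by rewrite !size_rcons szm.
    apply: (sorted_mask_add wwt szm szb sm sb); apply: maxm => //.
    exact: sorted_mask_rcons_true sb.
  case/lastP=> [|b' x]; rewrite !size_rcons // => -[szb'] sb' i.
  have sw : sorted_mask w b'.
    case: x sb' => [/sorted_mask_rcons_true|]; first exact.
    by rewrite sorted_mask_rcons_false.
  rewrite !nth_rcons szb' szm; case: ltnP => _; first exact: maxm.
  by case: eqP.
exists (rcons m false); split; first by rewrite !size_rcons szm.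
  by rewrite sorted_mask_rcons_false.
case/lastP=> [|b' x]; rewrite !size_rcons // => -[szb'] sb' i.
case: x sb' => sb'; first by case: no; exists b'.
rewrite sorted_mask_rcons_false // in sb'.
by rewrite !nth_rcons szb' szm; case: ltnP => // _; apply: maxm.
Qed.

(** * Restriction of the scan, length and lexicographic minimality *)

(** The scan skips the letters outside [m] without changing what remains, so removing them does not
    affect it. *)
Lemma mask_greedy w m u : size m = size w ->
  (forall i, nth false (greedy w u) i -> nth false m i) ->
  mask m (greedy w u) = greedy (mask m w) u.
Proof.
elim: w m u => [|s w IH] [|x m] u //= [sz] sub.
have {}IH := IH m _ sz (fun i => sub i.+1); have := sub 0 => /=.
case: x {sub} => /= [_|]; rewrite IH //.
by case: (N u s) => // /(_ isT).
Qed.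

(** The first letter of [l] is a descent of the product, so deletion strikes a letter from [l']; the
    tail of [l] follows by induction. *)
Lemma descent_free_size l l' : is_word S l -> is_word S l' ->
  descent_free l -> word_prod l' = word_prod l -> size l <= size l'.
Proof.
elim: l l' => [|s l IH] l' //= wsl wl' /andP[ns fl].
rewrite word_prod_cons => pl'.
have [Ss wl] := is_word_cons wsl.
have [||l'' [sub <- pl'']] := @deletion l' s; rewrite // ?pl' ?descent_mull //.
rewrite ltnS; apply: IH => //; first exact: is_word_subseq wl'.
by rewrite pl'' pl' gen_mulK.
Qed.

Lemma minimal_descent_free l : is_word S l ->
    (forall l', is_word S l' -> word_prod l' = word_prod l ->
       size l <= size l') ->
  descent_free l.
Proof.
elim: l => [|s l IH] //= wsl minl; have [Ss wl] := is_word_cons wsl.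
rewrite IH // ?andbT.
  apply/negP=> /(deletion wl) [l' [sub sz pl']].
  have := minl l' (is_word_subseq sub wl); rewrite word_prod_cons pl' -sz.
  by move=> /(_ erefl); rewrite ltnNge leqnSn.
move=> l' wl' pl'; rewrite -ltnS; apply: (minl (s :: l')).
  by move=> x; rewrite inE => /orP[/eqP->|/wl'].
by rewrite !word_prod_cons pl'.
Qed.

(** While the two agree, a letter picked by the reduced [b] is a descent of what remains, so the
    scan picks it too; the first disagreement is a letter that only the scan picks. *)
Lemma greedy_lex w b : is_word S w -> size b = size w ->
    descent_free (mask b w) -> let g := greedy w (word_prod (mask b w)) in
    g <> b -> exists i, [/\ i < size w, nth false g i, ~~ nth false b i &
                 forall j, j < i -> nth false g j = nth false b j].
Proof.
elim: w b => [|s w IH] [|x b] //= wsw [sz].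
have [Ss ww] := is_word_cons wsw; case: x => /= [/andP[ns fb]|fb].
  rewrite word_prod_cons descent_mull // ns gen_mulK // => neq.
  have [|i [iw gi bi lti]] := IH b ww sz fb.
    by move=> e; rewrite e in neq.
  by exists i.+1; split=> // -[|j] //; apply: lti.
case: ifP => [_ _|_ neq]; first by exists 0.
have [|i [iw gi bi lti]] := IH b ww sz fb; first by move=> e; rewrite e in neq.
by exists i.+1; split=> // -[|j] //; apply: lti.
Qed.

Hypothesis S_gen : forall u, exists2 l, is_word S l & word_prod l = u.

Lemma cox_lengthP u :
  (exists l, [/\ is_word S l, word_prod l = u & size l = cox_length S u]) /\
  (forall l, is_word S l -> word_prod l = u -> cox_length S u <= size l).
Proof.
pose P k := `[< exists l, [/\ is_word S l, word_prod l = u & size l = k] >].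
have exP : exists k, P k.
  by have [l wl pl] := S_gen u; exists (size l); apply/asboolP; exists l.
apply: (@xgetPex _ 0 (fun k =>
  (exists l, [/\ is_word S l, word_prod l = u & size l = k]) /\
  (forall l, is_word S l -> word_prod l = u -> k <= size l))).
case: (ex_minnP exP) => k /asboolP kP kmin; exists k; split=> // l wl pl.
by apply: kmin; apply/asboolP; exists l.
Qed.

Lemma reducedP l : is_word S l -> reduced S l <-> descent_free l.
Proof.
move=> wl; have [[l' [wl' pl' sl']] lmin] := cox_lengthP (word_prod l).
split=> [rl|fl].
  by apply: minimal_descent_free => // l''; rewrite rl; apply: lmin.
apply/eqP; rewrite eqn_leq lmin // andbT -sl'; exact: descent_free_size.
Qed.

End Cocycle.

(** * Index sets as bit masks *)

Definition set_mask n (I : {set 'I_n}) : bitseq :=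
  [seq i \in I | i <- enum 'I_n].
Definition mask_set n (m : bitseq) : {set 'I_n} :=
  [set i : 'I_n | nth false m i]%SET.

Lemma size_set_mask n (I : {set 'I_n}) : size (set_mask I) = n.
Proof. by rewrite size_map size_enum_ord. Qed.

Lemma nth_set_mask n (I : {set 'I_n}) (i : 'I_n) :
  nth false (set_mask I) i = (i \in I).
Proof. by rewrite (nth_map i) ?size_enum_ord // nth_ord_enum. Qed.

Lemma mask_setK n (m : bitseq) : size m = n -> set_mask (mask_set n m) = m.
Proof.
move=> sz; apply: (@eq_from_nth _ false); first by rewrite size_set_mask.
rewrite size_set_mask => i ilt.
by rewrite -[i]/(val (Ordinal ilt)) nth_set_mask inE.
Qed.

Lemma set_maskK n (I : {set 'I_n}) : mask_set n (set_mask I) = I.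
Proof. by apply/setP=> i; rewrite inE nth_set_mask. Qed.

Lemma enum_set_mask n (I : {set 'I_n}) : enum I = mask (set_mask I) (enum 'I_n).
Proof.
rewrite -filter_mask /enum_mem -filter_predI.
by apply: eq_filter => i; rewrite /= inE andbT.
Qed.

Lemma subwordE (W : groupType) n (w : n.-tuple W) (I : {set 'I_n}) :
  subword w I = mask (set_mask I) w :> seq W.
Proof.
rewrite -[in RHS](map_tnth_enum w) -map_mask -enum_set_mask.
apply: (@eq_from_nth _ 1) => [|i]; first by rewrite size_tuple size_map cardE.
rewrite size_tuple => ilt.
by rewrite -[i]/(val (Ordinal ilt)) -tnth_nth tnth_mktuple -(nth_image 1).
Qed.

Lemma nth_mask_set_mask n (I : {set 'I_n}) g (j : 'I_#|I|) : size g = n ->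
  nth false (mask (set_mask I) g) j = nth false g (enum_val j).
Proof.
move=> sz; rewrite -{1}(mask_setK sz) -map_mask -enum_set_mask.
by rewrite [LHS]nth_image inE.
Qed.

Lemma inherited_idx_mask n (I : {set 'I_n}) g : size g = n ->
    mask_set n g \subset I ->
  inherited_idx (mask_set #|I| (mask (set_mask I) g)) = mask_set n g.
Proof.
move=> sz /fintype.subsetP sub; apply/setP=> i.
apply/imsetP/idP => [[j + ->]|ig].
  by rewrite !inE nth_mask_set_mask.
have iI := sub i ig; exists (enum_rank_in iI i); last by rewrite enum_rankK_in.
by move: ig; rewrite !inE nth_mask_set_mask // enum_rankK_in.
Qed.

Lemma inherited_idx_subset n (I : {set 'I_n}) (J K : {set 'I_#|I|}) :
  (inherited_idx J \subset inherited_idx K) = (J \subset K).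
Proof.
apply/idP/idP => [/fintype.subsetP sub|]; last exact: imsetS.
apply/fintype.subsetP=> i iJ; have := sub (enum_val i).
by rewrite !(mem_imset _ _ enum_val_inj) => ->.
Qed.

Lemma lex_le_anti n (I J : {set 'I_n}) : lex_le I J -> lex_le J I -> I = J.
Proof.
case=> // -[i [id imin iI]] [//|[j [jd jmin jJ]]].
have ij : i = j.
  apply/val_inj/anti_leq; rewrite imin ?jmin //.
    by rewrite finset.setUC finset.setIC.
  by rewrite finset.setUC finset.setIC.
by move: id; rewrite !inE iI /= ij jJ.
Qed.

Lemma subword_eltsE (W : groupType) n (w : n.-tuple W) u :
  subword_elts w u <-> elts w u.
Proof.
split=> [[I <-]|[c /subseqP[m szm ->] <-]].
  by exists (subword w I); rewrite // subwordE mask_subseq.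
by exists (mask_set n m); rewrite subwordE mask_setK // szm size_tuple.
Qed.

(** * Sorted words are greedy words *)

Section SortIdx.
Variables (W : groupType) (S : set W) (N : W -> W -> bool).
Hypothesis S_inv : forall s, S s -> s * s = 1.
Hypothesis NM : forall u v x, N (u * v) x = N u x (+) N v (x ^ u).
Hypothesis NS : forall s x, S s -> N s x = (x == s).
Hypothesis S_gen : forall u, exists2 l, is_word S l & word_prod l = u.

(** [greedy_lex] makes the greedy set lexicographically least, and antisymmetry then determines the
    value of [xget]. *)
Lemma sort_idx_greedy n (w : n.-tuple W) u : is_word S w -> elts w u ->
  sort_idx S w u = mask_set n (greedy N w u).
Proof.
move=> ww ew; have [sg pg] := greedyP S_inv NM NS ww ew.
set g := greedy N w u in sg pg *.
have szg : size g = n by rewrite size_greedy size_tuple.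
have wmask m : is_word S (mask m w).
  by apply: is_word_subseq ww; apply: mask_subseq.
have redg : reduced_subword_for S w u (mask_set n g).
  split; rewrite subwordE mask_setK //.
  apply/(reducedP S_inv NM NS S_gen) => //.
  exact: sorted_mask_descent_free sg.
have ming J : reduced_subword_for S w u J -> lex_le (mask_set n g) J.
  rewrite /reduced_subword_for subwordE => -[pJ].
  move=> /(reducedP S_inv NM NS S_gen (wmask _)) fJ.
  have [gJ|gJ] := pselect (g = set_mask J); first by left; rewrite gJ set_maskK.
  have [||i []] := greedy_lex S_inv NM NS ww _ fJ.
  - by rewrite size_set_mask size_tuple.
  - by rewrite pJ.
  rewrite size_tuple pJ -/g => ilt gi.
  rewrite -[i]/(val (Ordinal ilt)) nth_set_mask => Ji lt.
  right; exists (Ordinal ilt); split; rewrite ?inE ?gi ?(negPf Ji) //.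
  move=> j; rewrite !inE -(nth_set_mask J) leqNgt => jd; apply/negP => /lt jE.
  by move: jd; rewrite jE; case: nth.
apply: xget_unique => // J [redJ minJ].
by apply: lex_le_anti; [apply: minJ|apply: ming].
Qed.
End SortIdx.

Theorem corollary4p6 (W : groupType) (S : set W) (hWS : coxeter_system S)
    (n : nat) (w : n.-tuple W) (hw : is_word S w) :
  exists I : {set 'I_n},
    [/\ reduced S (subword w I),
        subword_elts (subword w I) = subword_elts w,
        forall u : W, subword_elts w u ->
          inherited_idx (sort_idx S (subword w I) u) = sort_idx S w u
      & forall u v : W, subword_elts w u -> subword_elts w v ->
          (sorting_le S (subword w I) u v <-> sorting_le S w u v)].
Proof.
have [N [NM NS]] := reflection_cocycle hWS.
have S_inv s := @coxeter_gen_involutive _ _ s hWS.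
have S_gen u := word_of u hWS.
have [m [szm sm maxm]] := max_sorted_mask S_inv NM NS hw.
have szm' : size m = n by rewrite szm size_tuple.
have wI : subword w (mask_set n m) = mask m w :> seq W.
  by rewrite subwordE mask_setK.
have wm : is_word S (mask m w) by apply: is_word_subseq hw; apply: mask_subseq.
have sub u : elts w u -> forall i, nth false (greedy N w u) i -> nth false m i.
  by move=> /(greedyP S_inv NM NS hw)[sg _]; apply: maxm; rewrite ?size_greedy.
have eltsI u : elts (mask m w) u <-> elts w u.
  split=> [[c cm <-]|eu].
    by exists c => //; apply: subseq_trans cm (mask_subseq _ _).
  have [_ pg] := greedyP S_inv NM NS hw eu.
  exists (mask (greedy N w u) w) => //.
  by apply: submask_subseq (sub u eu); rewrite ?size_greedy.
have sortI u : subword_elts w u ->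
    inherited_idx (sort_idx S (subword w (mask_set n m)) u) = sort_idx S w u.
  move=> /subword_eltsE eu.
  (* Both sorted words are greedy; the mask on the subword is the one on [w] restricted to [m], and
     inheriting positions undoes the restriction. *)
  rewrite !(sort_idx_greedy S_inv NM NS S_gen) ?wI //; last exact/eltsI.
  rewrite -mask_greedy //; last exact: sub.
  have -> : mask m (greedy N w u)
    = mask (set_mask (mask_set n m)) (greedy N w u).
    by rewrite mask_setK.
  rewrite inherited_idx_mask ?size_greedy ?size_tuple //.
  by apply/fintype.subsetP=> i; rewrite !inE; apply: sub.
exists (mask_set n m); split=> //.
- rewrite wI; apply/(reducedP S_inv NM NS S_gen) => //.
  exact: sorted_mask_descent_free sm.
- apply/seteqP; split=> u /subword_eltsE; rewrite ?wI => /eltsI eu;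
    apply/subword_eltsE => //.
  by rewrite wI.
- by move=> u v eu ev; rewrite /sorting_le -!sortI // inherited_idx_subset.
Qed.
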